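(* Let $\mathbf I=(I,\rightarrow,0)$ be an effect implication algebra and define, for $x,y\in I$, $x':=x\rightarrow0$, $1:=0'$, and the partial operation $+$ by: $x+y$ is defined if and only if $x\rightarrow y'=1$, and in this case $x+y:=x'\rightarrow y$. Then $(I,+,{}',0,1)$ is an effect algebra satisfying the Ascending Chain Condition, whose induced order $\leq$ is given by $x\leq y$ if and only if $x\rightarrow y=1$.
   Context: An effect algebra is a structure $(E,+,{}',0,1)$ where $E$ is a set, ${}'$ is a unary operation on $E$, $0,1\in E$, and $+$ is a partial binary operation on $E$ such that for all $x,y,z\in E$: (E1) if $x+y$ is defined then so is $y+x$ and $x+y=y+x$; (E2) $(x+y)+z$ is defined if and only if $x+(y+z)$ is defined, and then they are equal; (E3) $x+y$ is defined and equals $1$ if and only if $y=x'$; (E4) if $1+x$ is defined then $x=0$. The induced order is $x\leq y$ iff there exists $z$ with $x+z=y$. The Ascending Chain Condition means there is no infinite strictly ascending chain in the induced order. An effect implication algebra is an algebra $(I,\rightarrow,0)$ with a binary operation $\rightarrow$ and a constant $0$ such that, writing $x':=x\rightarrow0$ and $1:=0'$, for all $x,y,z\in I$: (i) $0\rightarrow x=x\rightarrow x=x\rightarrow1=1$; (ii) if $x\rightarrow y=y\rightarrow x=1$ then $x=y$; (iii) if $x\rightarrow y=y\rightarrow z=1$ then $x\rightarrow z=1$; (iv) if $x\rightarrow y=1$ then $y'\rightarrow x'=1$; (v) $x''=x$; (vi) if $x\rightarrow y=1$ then $y\rightarrow x=x'\rightarrow y'$; (vii) [$x\rightarrow y'=1$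 and $(x'\rightarrow y)\rightarrow z'=1$] if and only if [$y\rightarrow z'=1$ and $x\rightarrow(y'\rightarrow z)'=1$], and in this case $(x'\rightarrow y)'\rightarrow z=x'\rightarrow(y'\rightarrow z)$; (viii) $x\rightarrow(y\rightarrow x)=1$; and there is no infinite sequence $a_1,a_2,a_3,\ldots$ of pairwise distinct elements of $I$ with $a_n\rightarrow a_{n+1}=1$ for all positive integers $n$. *)

(* Defs.v *)
From mathcomp Require Import all_boot.
From mathcomp Require Import boolp.

Set Implicit Arguments.
Unset Strict Implicit.
Unset Printing Implicit Defensive.

(* A partial binary operation on [E] is a function [add : E -> E -> option E];
   [add x y : bool], via the coercion [isSome], says that [x + y] is defined. *)

Record effect_algebra (E : Type) (add : E -> E -> option E)
    (compl : E -> E) (zero one : E) : Prop := EffectAlgebra {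
  ea_addC : forall x y, add x y -> add y x /\ add x y = add y x;
  (* [obind] is strict: (x + y) + z is defined iff x + y = u and u + z are. *)
  ea_addA : forall x y z,
    let l := obind (fun u => add u z) (add x y) in
    let r := obind (fun v => add x v) (add y z) in
    (l <-> r) /\ (l -> l = r);
  ea_compl : forall x y, add x y = Some one <-> y = compl x;
  ea_one : forall x, add one x -> x = zero
}.

Definition induced_le (E : Type) (add : E -> E -> option E) (x y : E) : Prop :=
  exists z, add x z = Some y.

Definition ascending_chain_condition (E : Type) (le : E -> E -> Prop) : Prop :=
  ~ exists a : nat -> E, forall n, le (a n) (a n.+1) /\ a n <> a n.+1.

Section Derived.
Variables (I : Type) (imp : I -> I -> I) (zero : I).

Definition imp_compl (x : I) : I := imp x zero.

Definition imp_one : I := imp_compl zero.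

Definition imp_add (x y : I) : option I :=
  if `[< imp x (imp_compl y) = imp_one >] then Some (imp (imp_compl x) y)
  else None.

End Derived.

Record effect_implication_algebra (I : Type) (imp : I -> I -> I) (zero : I)
    : Prop := EffectImplicationAlgebra {
  eia_top : let one := imp_one imp zero in
    forall x, [/\ imp zero x = one, imp x x = one & imp x one = one];
  eia_anti : let one := imp_one imp zero in
    forall x y, imp x y = one -> imp y x = one -> x = y;
  eia_trans : let one := imp_one imp zero in
    forall x y z, imp x y = one -> imp y z = one -> imp x z = one;
  eia_contra : let one := imp_one imp zero in let c := imp_compl imp zero in
    forall x y, imp x y = one -> imp (c y) (c x) = one;
  eia_complK : let c := imp_compl imp zero in
    forall x, c (c x) = x;
  eia_swap : let one := imp_one imp zero in let c := imp_compl imp zero in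
    forall x y, imp x y = one -> imp y x = imp (c x) (c y);
  eia_assoc : let one := imp_one imp zero in let c := imp_compl imp zero in
    forall x y z,
      let P := imp x (c y) = one /\ imp (imp (c x) y) (c z) = one in
      let Q := imp y (c z) = one /\ imp x (c (imp (c y) z)) = one in
      (P <-> Q) /\
      (P -> imp (c (imp (c x) y)) z = imp (c x) (imp (c y) z));
  eia_weak : let one := imp_one imp zero in
    forall x y, imp x (imp y x) = one;
  eia_acc : let one := imp_one imp zero in
    ~ exists a : nat -> I, injective a /\ forall n, imp (a n) (a n.+1) = one
}.

(* Main.v *)
Require Import Defs.
From mathcomp Require Import all_boot.
From mathcomp Require Import boolp.

(** The axioms (i)-(iii) make [x -> y = 1] a partial order, (iv)-(vi) make the
    partial sum commutative, and (vii) is its associativity.  The only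
    difference that has to be produced is [y - x = (x + y')'] for [x <= y]: as
    [(y' + x) + (x + y')' = 1], associativity gives
    [y' + (x + (x + y')') = 1], so [x + (x + y')' = y'' = y]. *)

(** This bridges two forms of the chain condition: consecutive terms differing, as in
    [ascending_chain_condition], and all terms differing, as in [eia_acc]. If [a m = a n] with
    [m < n], then [a m.+1] lies between [a m] and [a n], so antisymmetry forces [a m = a m.+1]. *)
Lemma strict_chain_inj (T : Type) (le : T -> T -> Prop) (a : nat -> T) :
  (forall x, le x x) ->
  (forall x y, le x y -> le y x -> x = y) ->
  (forall x y z, le x y -> le y z -> le x z) ->
  (forall n, le (a n) (a n.+1) /\ a n <> a n.+1) ->
  injective a.
Proof.
move=> le_refl le_anti le_trans a_strict.
have a_mono m n : m <= n -> le (a m) (a n).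
  move/subnKC <-; elim: (n - m) => [|k IHk]; first by rewrite addn0.
  by rewrite addnS; apply: le_trans IHk _; case: (a_strict (m + k)).
have a_lt m n : m < n -> a m <> a n.
  move=> lt_mn eq_a; case: (a_strict m) => le_a; apply.
  by apply: le_anti => //; rewrite eq_a; apply: a_mono.
move=> m n eq_a; case: (ltngtP m n) => // lt.
- by case: (a_lt _ _ lt).
- by case: (a_lt _ _ lt).
Qed.

Section EffectImplicationAlgebra.
Variables (I : Type) (imp : I -> I -> I) (zero : I).
Hypothesis HI : effect_implication_algebra imp zero.

Local Notation c := (imp_compl imp zero).
Local Notation one := (imp_one imp zero).
Local Notation add := (imp_add imp zero).
Local Notation le x y := (imp x y = one).

Let le_refl x : le x x. Proof. by case: (eia_top HI x). Qed.
Let complK x : c (c x) = x. Proof. exact: (eia_complK HI). Qed.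
Let le_anti x y : le x y -> le y x -> x = y.
Proof. exact: (eia_anti HI). Qed.

Lemma imp_addP x y u : add x y = Some u <-> le x (c y) /\ imp (c x) y = u.
Proof.
rewrite /imp_add; case: asboolP => [le_xy | nle_xy].
  by split=> [[<-] | [_ ->]].
by split=> // -[].
Qed.

Lemma imp_add_defined x y : add x y <-> le x (c y).
Proof. by rewrite /imp_add; case: asboolP. Qed.

Lemma imp_addE x y : le x (c y) -> add x y = Some (imp (c x) y).
Proof. by move=> le_xy; apply/imp_addP. Qed.

(** Contraposition (iv) moves definedness to the other order. The values agree by (vi) for [x] below
    [c y]: [c y -> x] equals [c x -> c (c y)], which is [c x -> y]. *)
Lemma imp_addC x y : add x y -> add y x /\ add x y = add y x.
Proof.
move/imp_add_defined => le_xy.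
have le_yx : le y (c x) by rewrite -[y]complK; exact: (eia_contra HI).
by rewrite !imp_addE // (eia_swap HI le_xy) complK.
Qed.

Lemma imp_addA x y z :
  let l := obind (fun u => add u z) (add x y) in
  let r := obind (fun v => add x v) (add y z) in
  (l <-> r) /\ (l -> l = r).
Proof.
have [PQ E] := eia_assoc HI x y z.
(* Unfolding the strict composition on each side yields exactly the two bracketed conditions of
   (vii). *)
have lP : obind (fun u => add u z) (add x y) <->
    le x (c y) /\ le (imp (c x) y) (c z).
  split; last by case=> xy xyz; rewrite (imp_addE _ _ xy) /= imp_addE.
  case xy: (add x y) => [u|] //= /imp_add_defined.
  by have /imp_addP[le_xy ->] := xy.
have rP : obind (fun v => add x v) (add y z) <->
    le y (c z) /\ le x (c (imp (c y) z)).
  split; last by case=> yz xyz; rewrite (imp_addE _ _ yz) /= imp_addE.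
  case yz: (add y z) => [u|] //= /imp_add_defined.
  by have /imp_addP[le_yz ->] := yz.
split; first by rewrite lP rP.
move/lP => Pxyz; have [yz x_yz] := PQ.1 Pxyz; have [xy xy_z] := Pxyz.
by rewrite (imp_addE _ _ xy) (imp_addE _ _ yz) /= !imp_addE // E.
Qed.

(** Definedness says that [y] is below [c x], by contraposition; the value being [one] says that
    [c x] is below [y]. Antisymmetry joins the two. *)
Lemma imp_add_compl x y : add x y = Some one <-> y = c x.
Proof.
rewrite imp_addP; split=> [[le_x_y' le_x'_y] | ->]; last by rewrite complK.
apply: le_anti => //.
by have := eia_contra HI le_x_y'; rewrite complK.
Qed.

Lemma imp_add_one x : add one x -> x = zero.
Proof.
move/imp_add_defined => le_1_x'; have [_ _ le_x'_1] := eia_top HI (c x).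
by rewrite -[x]complK (le_anti _ _ le_x'_1 le_1_x') /imp_one complK.
Qed.

Lemma imp_effect_algebra : effect_algebra add c zero one.
Proof.
split; [exact: imp_addC | exact: imp_addA | exact: imp_add_compl |].
exact: imp_add_one.
Qed.

Lemma imp_induced_le x y : induced_le add x y <-> le x y.
Proof.
split=> [[z xz] | le_xy].
  have /imp_addC[_ zx] : add x z by rewrite xz.
  (* Commuting first writes [y] as [c z -> x], with [x] as the consequent, which is the shape that
     (viii) bounds below by [x]. *)
  by move: zx; rewrite xz => /esym/imp_addP[_ <-]; exact: (eia_weak HI).
have xy' : add x (c y) by apply/imp_add_defined; rewrite complK.
have [_ y'x] := imp_addC _ _ xy'.
case eq_w: (add x (c y)) xy' => [w|] // _.
have ww' : add w (c w) = Some one by apply/imp_add_compl.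
exists (c w).
(* The left bracketing is already known to be [Some one], so associativity also yields that
   [x + c w] is defined; its value is then the complement of [c y]. *)
have [_] := imp_addA (c y) x (c w); rewrite -y'x eq_w /= ww' => /(_ isT).
case: (add x (c w)) => [v|] //= /esym/imp_add_compl ->.
by rewrite complK.
Qed.

Lemma imp_acc : ascending_chain_condition (induced_le add).
Proof.
case=> a a_strict.
have a_le n : le (a n) (a n.+1) /\ a n <> a n.+1.
  by case: (a_strict n) => /imp_induced_le.
apply: (eia_acc HI); exists a; split; last by move=> n; case: (a_le n).
exact: (strict_chain_inj _ (fun x y => le x y) _ le_refl le_anti
          (eia_trans HI) a_le).
Qed.

End EffectImplicationAlgebra.

Theorem theorem5p4 (I : Type) (imp : I -> I -> I) (zero : I)
  (HI : effect_implication_algebra imp zero) :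
  effect_algebra (imp_add imp zero) (imp_compl imp zero) zero (imp_one imp zero)
  /\ ascending_chain_condition (induced_le (imp_add imp zero))
  /\ (forall x y : I,
        induced_le (imp_add imp zero) x y <-> imp x y = imp_one imp zero).
Proof.
split; first exact: imp_effect_algebra.
by split; [exact: imp_acc | exact: imp_induced_le].
Qed.
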